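(* The families $C_{\varphi_6(u)},\ C_{\varphi_{6,2}(r)},\ C_{\varphi_9(t)},\ C_{\varphi_{12}(\nu)}$ are equivalent to the Kubert families with torsion $\mathbf Z/6\mathbf Z$, $\mathbf Z/6\mathbf Z+\mathbf Z/2\mathbf Z$, $\mathbf Z/9\mathbf Z$, $\mathbf Z/12\mathbf Z$ respectively. More explicitly, in each case below, after the indicated change of parameter the $j$-invariants coincide, and applying the change of coordinates $\Psi_k$ with the indicated $k$ to the Weierstrass form of $C_{\varphi}$ yields exactly the Weierstrass short normal form $K_w(b,c)$ of the corresponding Kubert curve: (1) for $C_{\varphi_6(u)}$: $u=-\dfrac{c-1}{2(3c+1)}$ and $k=\dfrac{c^2(c+1)}{(3c+1)^2}$; (2) for $C_{\varphi_{6,2}(r)}$: $r=-\dfrac{12}{c_1-3}$ and $k=\dfrac{4(c_1-5)^2(c_1-1)^2}{(c_1^2-6c_1+21)^2(c_1-3)(c_1+3)}$; (3) for $C_{\varphi_9(t)}$: $t=-\dfrac{f}{f-2}$ and $k=\dfrac{f^3(f-1)^3}{(f^3-3f^2+1)^2}$; (4) for $C_{\varphi_{12}(\nu)}$: $\nu=-\dfrac1{2\tau-1}$ and $k=\dfrac{(\tau-1)\tau^4(2\tau^2-2\tau+1)(2\tau-1)^2}{(6\tau^4-12\tau^3+12\tau^2-6\tau+1)^2}$.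
   Context: $C_s$ is the elliptic curve $y^2=x^3+a(s)x+b(s)$ with $a(s)=-\frac1{48}s^4+\frac12s^3$, $b(s)=-\frac1{24}s^5+\frac14s^4+\frac1{864}s^6$, and $$\varphi_6(u)=\frac{32}{(1+2u)(2u-1)^2},\qquad \varphi_{6,2}(r)=\frac{27(12+r^2)^3}{r^2(r-6)^2(r+6)^2},$$ $$\varphi_9(t)=-\frac18\,\frac{(-1+9t^2-3t+3t^3)^3}{t^3(t-1)^3(t+1)^3},\qquad \varphi_{12}(\nu)=-\frac{(\nu^4-6\nu^2-3)^3}{(\nu-1)^4(\nu+1)^4(1+\nu^2)}.$$ Kubert's normal form is $E(b,c): y^2+(1-c)xy-by=x^3-bx^2$. $K_w(b,c)$ is the Weierstrass short normal form $y^2=x^3+Ax+B$ obtained from $E(b,c)$ by first eliminating the terms linear in $y$ (completing the square, $y\mapsto y-\frac12((1-c)x-b)$) and then the coefficient of $x^2$ (translating $x$). For $E:y^2=x^3+Ax+B$ and $k$ in the base field, $\Psi_k(E)$ is $y^2=x^3+Ak^4x+Bk^6$. The Kubert families are: for $\mathbf Z/6\mathbf Z$, parameter $c$ with $b=c+c^2$; for $\mathbf Z/6\mathbf Z+\mathbf Z/2\mathbf Z$, parameter $c_1$ with $b=c+c^2$, $c=(10-2c_1)/(c_1^2-9)$; for $\mathbf Z/9\mathbf Z$, parameter $f$ with $b=cd$, $c=fd-f$, $d=f(f-1)+1$; for $\mathbf Z/12\mathbf Z$, parameter $\tau$ with $b=cd$, $c=fd-f$, $d=m+\tau$, $f=m/(1-\tau)$,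 $m=(3\tau-3\tau^2-1)/(\tau-1)$. Parameters are rational and such that all expressions are defined and the curves are nonsingular. *)

(* Defs.v *)
From HB Require Import structures.
From mathcomp Require Import all_boot all_order all_algebra.
From mathcomp Require Import ring.

Set Implicit Arguments.
Unset Strict Implicit.
Unset Printing Implicit Defensive.

Import Order.TTheory GRing.Theory Num.Theory.
Local Open Scope ring_scope.

(* y^2 + a1 x y + a3 y = x^3 + a2 x^2 + a4 x + a6, over the rationals *)
Record weier := Weier { a1 : rat; a2 : rat; a3 : rat; a4 : rat; a6 : rat }.

(* y^2 = x^3 + A x + B *)
Record short := Short { coefA : rat; coefB : rat }.

Definition weier_of_short (E : short) : weier :=
  Weier 0 0 0 (coefA E) (coefB E).
Coercion weier_of_short : short >-> weier.

Definition on_curve (E : weier) (x y : rat) : Prop :=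
  y ^+ 2 + a1 E * x * y + a3 E * y
  = x ^+ 3 + a2 E * x ^+ 2 + a4 E * x + a6 E.

Section Invariants.
Variable E : weier.

Definition b2 : rat := a1 E ^+ 2 + 4 * a2 E.
Definition b4 : rat := 2 * a4 E + a1 E * a3 E.
Definition b6 : rat := a3 E ^+ 2 + 4 * a6 E.
Definition b8 : rat :=
  a1 E ^+ 2 * a6 E + 4 * a2 E * a6 E - a1 E * a3 E * a4 E
  + a2 E * a3 E ^+ 2 - a4 E ^+ 2.
Definition c4 : rat := b2 ^+ 2 - 24 * b4.
Definition disc : rat :=
  - (b2 ^+ 2 * b8) - 8 * b4 ^+ 3 - 27 * b6 ^+ 2 + 9 * b2 * b4 * b6.

Definition nonsingular : bool := disc != 0.
Definition jinv : rat := c4 ^+ 3 / disc.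

(* Substitution x := x + r, y := y + s x + t; see [substP]. *)
Definition subst (r s t : rat) : weier :=
  Weier (a1 E + 2 * s)
        (a2 E - s * a1 E + 3 * r - s ^+ 2)
        (a3 E + r * a1 E + 2 * t)
        (a4 E - s * a3 E + 2 * r * a2 E - (t + r * s) * a1 E
         + 3 * r ^+ 2 - 2 * s * t)
        (a6 E + r * a4 E + r ^+ 2 * a2 E + r ^+ 3
         - t * a3 E - t ^+ 2 - r * t * a1 E).

End Invariants.

Lemma substP (E : weier) (r s t x y : rat) :
  on_curve (subst E r s t) x y <-> on_curve E (x + r) (y + s * x + t).
Proof.
rewrite /on_curve /=; split=> H; apply/eqP; rewrite -subr_eq0;
  move/eqP: H; rewrite -subr_eq0 => /eqP H; apply/eqP; rewrite -[RHS]H; ring.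
Qed.

Definition complete_square (E : weier) : weier :=
  subst E 0 (- (a1 E / 2)) (- (a3 E / 2)).

Definition kill_x2 (E : weier) : weier := subst E (- (a2 E / 3)) 0 0.

Definition short_form (E : weier) : short :=
  let E' := kill_x2 (complete_square E) in Short (a4 E') (a6 E').

Lemma short_formE (E : weier) :
  weier_of_short (short_form E) = kill_x2 (complete_square E).
Proof.
rewrite /short_form /weier_of_short /kill_x2 /complete_square /subst /=.
by congr Weier; field.
Qed.

Definition kubert (b c : rat) : weier := Weier (1 - c) (- b) (- b) 0 0.

Definition Kw (b c : rat) : short := short_form (kubert b c).

Definition Psi (k : rat) (E : short) : short :=
  Short (coefA E * k ^+ 4) (coefB E * k ^+ 6).

Definition C (s : rat) : short :=
  Short (- (1 / 48) * s ^+ 4 + 1 / 2 * s ^+ 3)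
        (- (1 / 24) * s ^+ 5 + 1 / 4 * s ^+ 4 + 1 / 864 * s ^+ 6).

(* Division by zero is total in MathComp, so each rational function comes with
   the predicate [.._def] saying that its denominators do not vanish. *)

Definition phi6_def (u : rat) : bool := (1 + 2 * u != 0) && (2 * u - 1 != 0).
Definition phi6 (u : rat) : rat := 32 / ((1 + 2 * u) * (2 * u - 1) ^+ 2).

Definition phi62_def (r : rat) : bool :=
  [&& r != 0, r - 6 != 0 & r + 6 != 0].
Definition phi62 (r : rat) : rat :=
  27 * (12 + r ^+ 2) ^+ 3 / (r ^+ 2 * (r - 6) ^+ 2 * (r + 6) ^+ 2).

Definition phi9_def (t : rat) : bool :=
  [&& t != 0, t - 1 != 0 & t + 1 != 0].
Definition phi9 (t : rat) : rat :=
  - (1 / 8) * ((- 1 + 9 * t ^+ 2 - 3 * t + 3 * t ^+ 3) ^+ 3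
               / (t ^+ 3 * (t - 1) ^+ 3 * (t + 1) ^+ 3)).

Definition phi12_def (v : rat) : bool :=
  [&& v - 1 != 0, v + 1 != 0 & 1 + v ^+ 2 != 0].
Definition phi12 (v : rat) : rat :=
  - ((v ^+ 4 - 6 * v ^+ 2 - 3) ^+ 3
     / ((v - 1) ^+ 4 * (v + 1) ^+ 4 * (1 + v ^+ 2))).

(* The pair (b, c) of a member of a Kubert family. *)
Definition kub6_def (c : rat) : bool := true.
Definition kub6 (c : rat) : rat * rat := (c + c ^+ 2, c).

Definition kub62_def (c1 : rat) : bool := c1 ^+ 2 - 9 != 0.
Definition kub62 (c1 : rat) : rat * rat :=
  let c := (10 - 2 * c1) / (c1 ^+ 2 - 9) in (c + c ^+ 2, c).

Definition kub9_def (f : rat) : bool := true.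
Definition kub9 (f : rat) : rat * rat :=
  let d := f * (f - 1) + 1 in
  let c := f * d - f in
  (c * d, c).

Definition kub12_def (tau : rat) : bool := (tau - 1 != 0) && (1 - tau != 0).
Definition kub12 (tau : rat) : rat * rat :=
  let m := (3 * tau - 3 * tau ^+ 2 - 1) / (tau - 1) in
  let f := m / (1 - tau) in
  let d := m + tau in
  let c := f * d - f in
  (c * d, c).

(* The families q |-> C_{phi q} and p |-> E(b, c), (b, c) = kub p, are
   equivalent through the change of parameter q = chg p, with the change of
   coordinates Psi_(k p); chg_def is the domain where chg and k are defined.
   The second clause says that every member of the C-family is reached. *)
Definition equivalent_families
    (phi_def : rat -> bool) (phi : rat -> rat)
    (kub_def : rat -> bool) (kub : rat -> rat * rat)
    (chg_def : rat -> bool) (chg k : rat -> rat) : Prop :=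
  (forall p : rat,
     let: (b, c) := kub p in
     kub_def p -> nonsingular (kubert b c) -> chg_def p ->
     let E := C (phi (chg p)) in
     [/\ phi_def (chg p), nonsingular E,
         jinv E = jinv (kubert b c),
         k p != 0 & Psi (k p) E = Kw b c])
  /\
  (forall q : rat,
     phi_def q -> nonsingular (C (phi q)) ->
     exists p : rat,
       let: (b, c) := kub p in
       [/\ kub_def p, nonsingular (kubert b c), chg_def p & q = chg p]).

(* Main.v *)
(* A curve with a rational 3-torsion point is y^2 + P x y + e y = x^3, and
   y^2 + P x y + e y = x^3 is the twist Psi_(e/P^2) of C_s for s = P^3/e.  So
   each case amounts to exhibiting the abscissa r of a 3-torsion point of
   E(b,c) (namely 2Q, 2Q, 3Q, 4Q for Q = (0,0)) with the corresponding P and e.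
   A parameter of C missed by the change of parameter satisfies s = 0 or
   s = 27, and there C_s is singular. *)
Require Import Defs.
From HB Require Import structures.
From mathcomp Require Import all_boot all_order all_algebra.
From mathcomp Require Import ring lra.

Import Order.TTheory GRing.Theory Num.Theory.
Local Open Scope ring_scope.

(** * Behaviour of c4, the discriminant and j under short forms and scaling *)

Lemma c4_short_form (E : weier) : c4 (short_form E) = c4 E.
Proof.
by case: E => ? ? ? ? ?; rewrite /c4 /b2 /b4 /=; field.
Qed.

Lemma disc_short_form (E : weier) : disc (short_form E) = disc E.
Proof.
by case: E => ? ? ? ? ?; rewrite /disc /b2 /b4 /b6 /b8 /=; field.
Qed.

Lemma c4_Psi (k : rat) (E : short) : c4 (Psi k E) = k ^+ 4 * c4 E.
Proof. by rewrite /c4 /b2 /b4 /=; ring. Qed.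

Lemma disc_Psi (k : rat) (E : short) : disc (Psi k E) = k ^+ 12 * disc E.
Proof. by rewrite /disc /b2 /b4 /b6 /b8 /=; ring. Qed.

Lemma nonsingular_Psi (k : rat) (E : short) :
  k != 0 -> nonsingular (Psi k E) = nonsingular E.
Proof.
by move=> k0; rewrite /nonsingular disc_Psi mulf_eq0 expf_eq0 (negPf k0).
Qed.

Lemma jinv_Psi (k : rat) (E : short) : k != 0 -> jinv (Psi k E) = jinv E.
Proof.
move=> k0; rewrite /jinv c4_Psi disc_Psi exprMn -exprM.
by rewrite -mulf_div divff ?mul1r // expf_neq0.
Qed.

Lemma nonsingular_short_form (E : weier) :
  nonsingular (short_form E) = nonsingular E.
Proof. by rewrite /nonsingular disc_short_form. Qed.

Lemma jinv_short_form (E : weier) : jinv (short_form E) = jinv E.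
Proof. by rewrite /jinv c4_short_form disc_short_form. Qed.

(** * Singular members of the two kinds of families *)

Lemma disc_C (s : rat) : disc (C s) = s ^+ 8 * (s - 27).
Proof. by rewrite /disc /b2 /b4 /b6 /b8 /=; field. Qed.

Lemma nonsingular_C (s : rat) :
  nonsingular (C s) -> s != 0 /\ s != 27.
Proof.
rewrite /nonsingular disc_C mulf_eq0 expf_eq0 subr_eq0 /= negb_or.
by case/andP.
Qed.

(** At b = 0 the equation becomes y^2 + (1 - c) x y = x^3, which is singular at the origin. *)
Lemma nonsingular_kubert (b c : rat) : nonsingular (kubert b c) -> b != 0.
Proof.
apply: contraNneq => ->; rewrite /disc /b2 /b4 /b6 /b8 /=; apply/eqP; ring.
Qed.

(* The hypotheses compare b2, b4, b6 after the translation x := x + r. *)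
Lemma short_form_translate (E F : weier) (r : rat) :
  b2 F = b2 E + 12 * r ->
  b4 F = b4 E + r * b2 E + 6 * r ^+ 2 ->
  b6 F = b6 E + 2 * r * b4 E + r ^+ 2 * b2 E + 4 * r ^+ 3 ->
  short_form F = short_form E.
Proof.
(* Completing the square leaves y^2 = x^3 + (b2/4) x^2 + (b4/2) x + b6/4, so the short form depends
   on [b2], [b4], [b6] alone. *)
have sfE (G : weier) : short_form G =
    Short (b4 G / 2 - b2 G ^+ 2 / 48)
          (b6 G / 4 - b2 G * b4 G / 24 + b2 G ^+ 3 / 864).
  by case: G => ? ? ? ? ?; rewrite /short_form /b2 /b4 /b6 /=; congr Short; field.
by move=> H2 H4 H6; rewrite !sfE H2 H4 H6; congr Short; field.
Qed.

(** [C s] is the short form of y^2 + s x y + s^2 y = x^3. Scaling by k turns the coefficients (s,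
    s^2) into (k s, k^3 s^2), which is (P, e) for s = P^3/e and k = e/P^2. *)
Lemma Psi_C_3torsion (P e : rat) : P != 0 -> e != 0 ->
  Psi (e / P ^+ 2) (C (P ^+ 3 / e)) = short_form (Weier P 0 e 0 0).
Proof.
by move=> P0 e0; rewrite /Psi /short_form /=; congr Short; field; rewrite ?P0 ?e0.
Qed.

(** The last three hypotheses match [b2], [b4], [b6] of y^2 + P x y + e y = x^3 with those of E(b,c)
    moved by r. They fix (P, e) up to a common sign, which does not affect s and only changes the
    sign of k. *)
Lemma Psi_C_Kw (P e r b c s k : rat) : P != 0 -> e != 0 ->
  s = P ^+ 3 / e -> k = e / P ^+ 2 ->
  P ^+ 2 = (1 - c) ^+ 2 - 4 * b + 12 * r ->
  P * e = r * ((1 - c) ^+ 2 - 4 * b) - (1 - c) * b + 6 * r ^+ 2 ->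
  e ^+ 2 = b ^+ 2 - 2 * r * (1 - c) * b + r ^+ 2 * ((1 - c) ^+ 2 - 4 * b)
           + 4 * r ^+ 3 ->
  Psi k (C s) = Kw b c.
Proof.
move=> P0 e0 -> -> H2 H4 H6; rewrite Psi_C_3torsion //.
apply: (@short_form_translate _ _ r); rewrite /b2 /b4 /b6 /=.
- by rewrite mulr0 addr0 H2; ring.
- by rewrite mulr0 add0r H4; ring.
- by rewrite mulr0 addr0 H6; ring.
Qed.

Lemma kub6_neq0 (c : rat) : (c + c ^+ 2 != 0) = (c != 0) && (c + 1 != 0).
Proof. by rewrite -negb_or -mulf_eq0 mulrDr mulr1 addrC. Qed.

(** Shared by the first two cases, since the Z/6 + Z/2 family is a subfamily of the Z/6 family. *)
Lemma Psi_C_Kw6 (c s k : rat) : c != 0 -> c + 1 != 0 -> 3 * c + 1 != 0 ->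
  s = (3 * c + 1) ^+ 3 / (c ^+ 2 * (c + 1)) ->
  k = c ^+ 2 * (c + 1) / (3 * c + 1) ^+ 2 ->
  Psi k (C s) = Kw (c + c ^+ 2) c.
Proof.
move=> c0 c10 P0 Hs Hk.
(* Here 2Q = (b, bc), hence r = b; P = 3c + 1 and e = c^2 (c + 1) are read off from [Hs] and
   [Hk]. *)
apply: (@Psi_C_Kw _ _ (c + c ^+ 2) _ _ _ _ P0 _ Hs Hk); try ring.
by rewrite mulf_neq0 ?expf_neq0.
Qed.

(** Everything follows from the [Psi] identity once k is nonzero, because it carries nonsingularity
    and j across in both directions. For a Kubert curve k is nonzero because b is; for a member of
    the C-family, because [phi] is defined at its parameter. *)
Lemma equivalent_familiesP (phi_def : rat -> bool) (phi : rat -> rat)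
    (kub_def : rat -> bool) (kub : rat -> rat * rat)
    (chg_def : rat -> bool) (chg k : rat -> rat) :
  (forall p, kub_def p -> chg_def p ->
     [/\ (kub p).1 != 0 -> k p != 0,
         phi_def (chg p) = (k p != 0)
       & k p != 0 -> Psi (k p) (C (phi (chg p))) = Kw (kub p).1 (kub p).2]) ->
  (forall q, phi_def q -> phi q != 0 -> phi q != 27 ->
     exists p, [/\ kub_def p, chg_def p & q = chg p]) ->
  equivalent_families phi_def phi kub_def kub chg_def chg k.
Proof.
move=> Hp Hinv; split=> [p | q].
  have := Hp p; case: (kub p) => b c /= {}Hp Kp ns Cp.
  have [Hb Hdef HPsi] := Hp Kp Cp.
  have k0 := Hb (nonsingular_kubert _ _ ns); have HP := HPsi k0.
  split; last exact: HP.
  - by rewrite Hdef.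
  - by rewrite -(nonsingular_Psi _ _ k0) HP nonsingular_short_form.
  - by rewrite -(jinv_Psi _ _ k0) HP jinv_short_form.
  - exact: k0.
move=> phiq ns; have [s0 s27] := nonsingular_C _ ns.
have [p [Kp Cp Eq]] := Hinv q phiq s0 s27; exists p.
have := Hp p Kp Cp; case: (kub p) => b c [_ Hdef HPsi].
have k0 : k p != 0 by rewrite -Hdef -Eq.
have HP := HPsi k0; split.
- exact: Kp.
- rewrite -nonsingular_short_form -/(Kw b c) -HP (nonsingular_Psi _ _ k0) -Eq.
  exact: ns.
- exact: Cp.
- exact: Eq.
Qed.

Theorem proposition4p18 :
  [/\ equivalent_families phi6_def phi6 kub6_def kub6
        (fun c => 3 * c + 1 != 0)
        (fun c => - ((c - 1) / (2 * (3 * c + 1))))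
        (fun c => c ^+ 2 * (c + 1) / (3 * c + 1) ^+ 2),
      equivalent_families phi62_def phi62 kub62_def kub62
        (fun c1 => [&& c1 - 3 != 0, c1 + 3 != 0
                     & c1 ^+ 2 - 6 * c1 + 21 != 0])
        (fun c1 => - (12 / (c1 - 3)))
        (fun c1 => 4 * (c1 - 5) ^+ 2 * (c1 - 1) ^+ 2
                   / ((c1 ^+ 2 - 6 * c1 + 21) ^+ 2 * (c1 - 3) * (c1 + 3))),
      equivalent_families phi9_def phi9 kub9_def kub9
        (fun f => (f - 2 != 0) && (f ^+ 3 - 3 * f ^+ 2 + 1 != 0))
        (fun f => - (f / (f - 2)))
        (fun f => f ^+ 3 * (f - 1) ^+ 3 / (f ^+ 3 - 3 * f ^+ 2 + 1) ^+ 2)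
    & equivalent_families phi12_def phi12 kub12_def kub12
        (fun tau => (2 * tau - 1 != 0)
           && (6 * tau ^+ 4 - 12 * tau ^+ 3 + 12 * tau ^+ 2 - 6 * tau + 1 != 0))
        (fun tau => - (1 / (2 * tau - 1)))
        (fun tau => (tau - 1) * tau ^+ 4 * (2 * tau ^+ 2 - 2 * tau + 1)
                    * (2 * tau - 1) ^+ 2
                    / (6 * tau ^+ 4 - 12 * tau ^+ 3 + 12 * tau ^+ 2
                       - 6 * tau + 1) ^+ 2)].
Proof.
split; apply: equivalent_familiesP.

(* Torsion Z/6 *)
- move=> c _ Q0.
  have k0E : (c ^+ 2 * (c + 1) / (3 * c + 1) ^+ 2 != 0)
      = (c != 0) && (c + 1 != 0).
    by rewrite !(expf_eq0, mulf_eq0, invr_eq0) (negPf Q0) !orbF /= !negb_or.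
  have E1 : 1 + 2 * - ((c - 1) / (2 * (3 * c + 1))) = 2 * (c + 1) / (3 * c + 1).
    by field; rewrite Q0.
  have E2 : 2 * - ((c - 1) / (2 * (3 * c + 1))) - 1 = - 4 * c / (3 * c + 1).
    by field; rewrite Q0.
  split.
  + by rewrite k0E -kub6_neq0.
  + rewrite k0E /phi6_def E1 E2 !(expf_eq0, mulf_eq0, invr_eq0) (negPf Q0).
    by rewrite !orbF /= andbC.
  + rewrite k0E => /andP[c0 c10]; apply: Psi_C_Kw6 => //; rewrite /phi6 E1 E2.
    by field; rewrite ?Q0 ?c0 ?c10.
- move=> q /andP[q1 q2] s0 s27.
  (* The value u = -1/6 is the image of c = infinity, and there s = 27. *)
  have q6 : 6 * q + 1 != 0.
    apply: contraNneq s27 => q6; have -> : q = - 1 / 6 by lra.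
    by apply/eqP; rewrite /phi6; field.
  have Ec : 3 * ((1 - 2 * q) / (6 * q + 1)) + 1 = 4 / (6 * q + 1).
    by field; rewrite q6.
  (* The inverse of the Moebius map giving u in terms of c. *)
  exists ((1 - 2 * q) / (6 * q + 1)); split; first exact: isT.
    by rewrite Ec mulf_eq0 invr_eq0 (negPf q6).
  by rewrite Ec; field; rewrite ?q6.

(* Torsion Z/6 + Z/2 *)
- move=> c1 K0 /and3P[m3 p3 Q0].
  set c := (10 - 2 * c1) / (c1 ^+ 2 - 9).
  have cE : c = - (2 * (c1 - 5)) / ((c1 - 3) * (c1 + 3)).
    by rewrite /c; field; rewrite m3 p3.
  have c1E : c + 1 = (c1 - 1) ^+ 2 / ((c1 - 3) * (c1 + 3)).
    by rewrite cE; field; rewrite m3 p3.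
  have PE : 3 * c + 1 = (c1 ^+ 2 - 6 * c1 + 21) / ((c1 - 3) * (c1 + 3)).
    by rewrite cE; field; rewrite m3 p3.
  have k0E : (4 * (c1 - 5) ^+ 2 * (c1 - 1) ^+ 2
               / ((c1 ^+ 2 - 6 * c1 + 21) ^+ 2 * (c1 - 3) * (c1 + 3)) != 0)
      = (c1 - 5 != 0) && (c1 - 1 != 0).
    rewrite !(expf_eq0, mulf_eq0, invr_eq0) (negPf Q0) (negPf m3) (negPf p3).
    by rewrite !orbF /= !negb_or.
  have E1 : - (12 / (c1 - 3)) - 6 = - 6 * (c1 - 1) / (c1 - 3).
    by field; rewrite m3.
  have E2 : - (12 / (c1 - 3)) + 6 = 6 * (c1 - 5) / (c1 - 3).
    by field; rewrite m3.
  split.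
  + rewrite k0E /kub62 -/c [_.1]/= kub6_neq0 c1E cE.
    rewrite !(expf_eq0, mulf_eq0, oppr_eq0, invr_eq0) (negPf m3) (negPf p3).
    by rewrite !orbF.
  + rewrite k0E /phi62_def E1 E2 !(mulf_eq0, oppr_eq0, invr_eq0) (negPf m3).
    by rewrite !orbF /= andbC.
  + rewrite k0E => /andP[n5 n1]; apply: (@Psi_C_Kw6 c).
    * rewrite cE !(mulf_eq0, oppr_eq0, invr_eq0) (negPf n5) (negPf m3).
      by rewrite (negPf p3).
    * rewrite c1E !(expf_eq0, mulf_eq0, invr_eq0) (negPf n1) (negPf m3).
      by rewrite (negPf p3).
    * by rewrite PE !(mulf_eq0, invr_eq0) (negPf Q0) (negPf m3) (negPf p3).
    * rewrite /phi62 E1 E2 PE c1E cE.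
      by field; rewrite ?m3 ?p3 ?n5 ?n1.
    * rewrite PE c1E cE; field.
      by rewrite ?m3 ?p3 ?n5 ?n1 ?Q0.
- move=> q /and3P[q0 q6 p6] s0 s27.
  (* The value r = 2 corresponds to c1 = -3, a pole of c, and there s = 27. *)
  have q2 : q - 2 != 0.
    rewrite subr_eq0; apply: contraNneq s27 => ->.
    by apply/eqP; rewrite /phi62; field.
  have E3 : 3 - 12 / q - 3 = - 12 / q by field; rewrite q0.
  have E4 : 3 - 12 / q + 3 = 6 * (q - 2) / q by field; rewrite q0.
  exists (3 - 12 / q); split.
  + rewrite /kub62_def.
    have -> : (3 - 12 / q) ^+ 2 - 9 = (3 - 12 / q - 3) * (3 - 12 / q + 3) by ring.
    by rewrite E3 E4 !(mulf_eq0, invr_eq0) (negPf q0) (negPf q2).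
  + apply/and3P; split.
    * by rewrite E3 !(mulf_eq0, invr_eq0) (negPf q0).
    * by rewrite E4 !(mulf_eq0, invr_eq0) (negPf q0) (negPf q2).
    (* This quadratic in c1 is (c1 - 3)^2 + 12, positive over the rationals. *)
    * have -> : (3 - 12 / q) ^+ 2 - 6 * (3 - 12 / q) + 21
          = (3 - 12 / q - 3) ^+ 2 + 12 by ring.
      by apply: lt0r_neq0; apply: ltr_wpDl; [exact: sqr_ge0 | rewrite ltr0n].
  + by rewrite E3; field; rewrite q0.

(* Torsion Z/9 *)
- move=> f _ /andP[f2 Q0].
  have k0E : (f ^+ 3 * (f - 1) ^+ 3 / (f ^+ 3 - 3 * f ^+ 2 + 1) ^+ 2 != 0)
      = (f != 0) && (f - 1 != 0).
    by rewrite !(expf_eq0, mulf_eq0, invr_eq0) (negPf Q0) !orbF /= !negb_or.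
  have E1 : - (f / (f - 2)) - 1 = - 2 * (f - 1) / (f - 2) by field; rewrite f2.
  have E2 : - (f / (f - 2)) + 1 = - 2 / (f - 2) by field; rewrite f2.
  split.
  (* Both f = 0 and f = 1 give c = 0, hence b = 0. *)
  + rewrite k0E /kub9 [_.1]/= -negb_or; apply: contraNN => /orP[] /eqP Z.
      by apply/eqP; rewrite Z; ring.
    by apply/eqP; rewrite Z; ring.
  + rewrite k0E /phi9_def E1 E2.
    by rewrite !(mulf_eq0, oppr_eq0, invr_eq0) (negPf f2) !orbF /= andbT.
  + rewrite k0E => /andP[f0 f1].
    (* Here 3Q = (c, b - c), hence r = c; P is a square root of [b2] + 12 r, with the sign of e
       chosen to match the given k. *)
    apply: (@Psi_C_Kw (f ^+ 3 - 3 * f ^+ 2 + 1) (f ^+ 3 * (f - 1) ^+ 3)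
              (kub9 f).2); rewrite /kub9 ?[_.1]/= ?[_.2]/=.
    * exact: Q0.
    * by rewrite mulf_neq0 // expf_neq0.
    * rewrite /phi9 E1 E2.
      have -> : - 1 + 9 * (- (f / (f - 2))) ^+ 2 - 3 * - (f / (f - 2))
                + 3 * (- (f / (f - 2))) ^+ 3
          = 8 * (f ^+ 3 - 3 * f ^+ 2 + 1) / (f - 2) ^+ 3.
        by field; rewrite f2.
      by field; rewrite f0 f1 f2.
    * by [].
    * ring.
    * ring.
    * ring.
- move=> q /and3P[q0 q1 p1] s0 _.
  have E1 : 2 * q / (q + 1) - 2 = - 2 / (q + 1) by field; rewrite p1.
  exists (2 * q / (q + 1)); split; first exact: isT; rewrite E1.
  + apply/andP; split.
      by rewrite !(mulf_eq0, oppr_eq0, invr_eq0) (negPf p1).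
    (* Up to a nonzero factor, the denominator of k is the cubic whose cube is the numerator of
       [phi9]; its vanishing would give s = 0. *)
    have -> : (2 * q / (q + 1)) ^+ 3 - 3 * (2 * q / (q + 1)) ^+ 2 + 1
        = - (- 1 + 9 * q ^+ 2 - 3 * q + 3 * q ^+ 3) / (q + 1) ^+ 3.
      by field; rewrite p1.
    rewrite mulf_eq0 oppr_eq0 invr_eq0 expf_eq0 (negPf p1) orbF.
    apply: contraNneq s0 => N0.
    by rewrite /phi9 N0 expr0n mul0r mulr0.
  + by field; rewrite p1.

(* Torsion Z/12 *)
- move=> tau /andP[m1 _] /andP[w0 Q0].
  have n0 : 2 * tau ^+ 2 - 2 * tau + 1 != 0.
    have -> : 2 * tau ^+ 2 - 2 * tau + 1 = tau ^+ 2 + (tau - 1) ^+ 2 by ring.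
    apply: lt0r_neq0; apply: ltr_wpDl; first exact: sqr_ge0.
    by rewrite exprn_even_gt0.
  set k := (X in X != 0 -> Psi X _ = _).
  have k0E : (k != 0) = (tau != 0).
    rewrite /k !(expf_eq0, mulf_eq0, invr_eq0) (negPf Q0) (negPf m1) (negPf n0).
    by rewrite (negPf w0) !orbF.
  have E1 : - (1 / (2 * tau - 1)) - 1 = - 2 * tau / (2 * tau - 1).
    by field; rewrite w0.
  have E2 : - (1 / (2 * tau - 1)) + 1 = 2 * (tau - 1) / (2 * tau - 1).
    by field; rewrite w0.
  have E3 : 1 + (- (1 / (2 * tau - 1))) ^+ 2
      = 2 * (2 * tau ^+ 2 - 2 * tau + 1) / (2 * tau - 1) ^+ 2.
    by field; rewrite w0.
  (* The factored form of (b, c), which shows that b vanishes at tau = 0. *)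
  have -> : kub12 tau =
      ((3 * tau ^+ 2 - 3 * tau + 1) * (2 * tau ^+ 2 - 2 * tau + 1)
         * tau * (2 * tau - 1) / (tau - 1) ^+ 4,
       - (3 * tau ^+ 2 - 3 * tau + 1) * tau * (2 * tau - 1) / (tau - 1) ^+ 3).
    have m1' : 1 - tau != 0 by rewrite -opprB oppr_eq0.
    by rewrite /kub12; congr pair; field; rewrite m1 m1'.
  rewrite k0E [_.1]/= [_.2]/=; split.
  + by apply: contraNneq => ->; rewrite mulr0 !mul0r.
  + rewrite /phi12_def E1 E2 E3 !(expf_eq0, mulf_eq0, oppr_eq0, invr_eq0).
    by rewrite (negPf w0) (negPf m1) (negPf n0) !orbF /= andbT.
  + move=> t0.
    (* The third argument is r = d (d - 1), the abscissa of 4Q, with d = m + tau = -(2 tau^2 - 2 tau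
       + 1)/(tau - 1). *)
    apply: (@Psi_C_Kw
      ((6 * tau ^+ 4 - 12 * tau ^+ 3 + 12 * tau ^+ 2 - 6 * tau + 1)
         / (tau - 1) ^+ 3)
      (tau ^+ 4 * (2 * tau ^+ 2 - 2 * tau + 1) * (2 * tau - 1) ^+ 2
         / (tau - 1) ^+ 5)
      (tau * (2 * tau - 1) * (2 * tau ^+ 2 - 2 * tau + 1) / (tau - 1) ^+ 2)).
    * by rewrite mulf_eq0 invr_eq0 expf_eq0 (negPf Q0) (negPf m1).
    * rewrite !(expf_eq0, mulf_eq0, invr_eq0) (negPf t0) (negPf n0) (negPf w0).
      by rewrite (negPf m1).
    * rewrite /phi12 E1 E2 E3.
      have -> : (- (1 / (2 * tau - 1))) ^+ 4
                - 6 * (- (1 / (2 * tau - 1))) ^+ 2 - 3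
          = - 8 * (6 * tau ^+ 4 - 12 * tau ^+ 3 + 12 * tau ^+ 2 - 6 * tau + 1)
            / (2 * tau - 1) ^+ 4.
        by field; rewrite w0.
      by field; rewrite t0 w0 m1 n0.
    * by rewrite /k; field; rewrite Q0 m1.
    * by field; rewrite m1.
    * by field; rewrite m1.
    * by field; rewrite m1.
- move=> q /and3P[m1 p1 n0] s0 s27.
  (* The value nu = 0 is the image of tau = infinity, and there s = 27. *)
  have q0 : q != 0.
    apply: contraNneq s27 => ->.
    by apply/eqP; rewrite /phi12; field.
  have E1 : (q - 1) / (2 * q) - 1 = - (q + 1) / (2 * q) by field; rewrite q0.
  have E2 : 2 * ((q - 1) / (2 * q)) - 1 = - 1 / q by field; rewrite q0.
  exists ((q - 1) / (2 * q)); split.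
  + rewrite /kub12_def -[1 - _]opprB oppr_eq0 andbb E1.
    by rewrite !(mulf_eq0, oppr_eq0, invr_eq0) (negPf p1) (negPf q0).
  + apply/andP; split.
      by rewrite E2 !(mulf_eq0, oppr_eq0, invr_eq0) (negPf q0).
    (* The quartic in tau is, up to a nonzero factor, the quartic in nu whose cube is the numerator
       of [phi12], so it is nonzero because s is. *)
    set Q := (X in X != 0).
    have -> : Q = - (q ^+ 4 - 6 * q ^+ 2 - 3) / (8 * q ^+ 4).
      by rewrite /Q; field; rewrite q0.
    move: s0; rewrite /phi12 !(expf_eq0, mulf_eq0, oppr_eq0, invr_eq0) !negb_or.
    by rewrite q0 => /andP[-> _].
  + by rewrite E2; field; rewrite q0.
Qed.
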